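(* Let $m\in\mathrm{Met}(A)$ be a metric on the real finite-dimensional affine space $A$ and $\mathcal R=(R_0,\dots,R_n)$ any affine referential of $A$. The functionals $v_{R_0},\dots,v_{R_n},v_m$ form a basis of $\mathrm{Aff}(\mathrm{Quad}_mA)$. The corresponding dual basis is $w_0,\dots,w_n,\delta^m_{\mathcal R}\in\widehat{\mathrm{Quad}_mA}$, where $w_0,\dots,w_n\in\mathrm{Aff}(A)$ are the barycentric coordinate functions associated to the referential and $\delta^m_{\mathcal R}$ is the $\mathcal R$-reduced quadratic function associated to the metric.
   Context: All spaces are real and finite-dimensional. $\mathrm{Aff}(A)$ is the vector space of affine functions $A\to\mathbb R$. An affine referential of $A$ ($n=\dim A$) is a sequence of $n+1$ affinely independent points $(R_0,\dots,R_n)$; its barycentric coordinate functions $w_i\in\mathrm{Aff}(A)$ are determined by $w_i(R_j)=1$ if $i=j$ and $0$ otherwise. A function $\delta:A\to\mathbb R$ is quadratic if $\delta(\alpha P+\beta Q)=\alpha(\alpha-\beta)\delta(P)+\beta(\beta-\alpha)\delta(Q)+4\alpha\beta\,\delta(\frac{P+Q}2)$ for all $P,Q\in A$ and $\alpha+\beta=1$; $\mathrm{Quad}(A)$ is the vector space of these, and $\mathrm{Met}(A)=\mathrm{Quad}(A)/\mathrm{Aff}(A)$ is the space of metrics. For $m\in\mathrm{Met}(A)$, $\mathrm{Quad}_mA\subset\mathrm{Quad}(A)$ is the class $m$, an affine space with director space $\mathrm{Aff}(A)$. The $\mathcal R$-reduced quadratic function $\delta^m_{\mathcal R}$ is the unique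 element of $\mathrm{Quad}_mA$ vanishing at every $R_i$. $\mathrm{Aff}(\mathrm{Quad}_mA)$ is the vector space of affine functionals $\mathrm{Quad}_mA\to\mathbb R$; its dual space is the linear hull $\widehat{\mathrm{Quad}_mA}$, in which $\mathrm{Quad}_mA$ is embedded by evaluation ($\langle\delta,\bar v\rangle=\bar v(\delta)$). $v_P(\delta)=\delta(P)$ for $P\in A$, $v_m(\delta)=1$. Affine functions $s\in\mathrm{Aff}(A)$ are regarded as elements of $\widehat{\mathrm{Quad}_mA}$ via the injective map $\mathrm d_m^*:\mathrm{Aff}(A)\hookrightarrow\widehat{\mathrm{Quad}_mA}$, $\langle\mathrm d_m^*s,\bar v\rangle=\bar v(\delta+s)-\bar v(\delta)$ (any $\delta\in\mathrm{Quad}_mA$). *)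

(* Defs.v *)
From HB Require Import structures.
From mathcomp Require Import all_boot all_order all_algebra.
From mathcomp Require Import ring_quotient.
From mathcomp Require Import all_classical all_reals.
From mathcomp Require Import ring lra.

Set Implicit Arguments.
Unset Strict Implicit.
Unset Printing Implicit Defensive.

Import GRing.Theory Num.Theory.
Import VectorInternalTheory.
Export Quotient.Exports.

Local Open Scope ring_scope.
Local Open Scope quotient_scope.

Reserved Notation "P +@ v" (at level 50, left associativity).
Reserved Notation "Q -@ P" (at level 50, left associativity).

(* A nonempty set with a free and transitive action of the finite-dimensional
   real vector space V; Q -@ P is the unique vector carrying P to Q. *)
Record affineSpace (R : realType) (V : vectType R) := AffineSpace {
  carrier :> Type;
  vadd : carrier -> V -> carrier;
  vsub : carrier -> carrier -> V;
  vadd0 : forall P, vadd P 0 = P;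
  vaddA : forall P u v, vadd (vadd P u) v = vadd P (u + v);
  vsubK : forall P Q, vadd P (vsub Q P) = Q;
  vaddK : forall P v, vsub (vadd P v) P = v;
  affine_inhabited : inhabited carrier }.

Notation "P +@ v" := (vadd P v) : ring_scope.
Notation "Q -@ P" := (vsub Q P) : ring_scope.

Definition adim (R : realType) (V : vectType R) (A : affineSpace V) : nat :=
  \dim {: V}.

Section AffineSpaceTheory.
Variables (R : realType) (V : vectType R) (A : affineSpace V).
Implicit Types (P Q : A) (a b : R).

Lemma origin_exists : exists _ : A, True.
Proof. by case: (affine_inhabited A) => P; exists P. Qed.
Definition origin : A := sval (cid origin_exists).

(* The affine combination aP + bQ; meaningful only when a + b = 1. *)
Definition acomb a P b Q : A := P +@ (b *: (Q -@ P)).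

Lemma vsubC P Q v : (P +@ v) -@ Q = (P -@ Q) + v.
Proof. by rewrite -{1}(vsubK Q P) vaddA vaddK. Qed.

Lemma vsubxx P : P -@ P = 0.
Proof. by have := vaddK P 0; rewrite vadd0. Qed.

Lemma vsub_chain P Q O : (P -@ O) - (Q -@ O) = P -@ Q.
Proof. by rewrite -{1}(vsubK Q P) vsubC addrC addrA addNr add0r. Qed.

Lemma acomb_vsub a P b Q O : a + b = 1 ->
  acomb a P b Q -@ O = a *: (P -@ O) + b *: (Q -@ O).
Proof.
move=> ab1; rewrite vsubC -(vsub_chain Q P O).
have -> : a = 1 - b by rewrite -ab1 addrK.
by rewrite scalerBl scale1r scalerBr addrA addrAC.
Qed.

Lemma acombC a P b Q : a + b = 1 -> acomb a P b Q = acomb b Q a P.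
Proof.
move=> ab1; rewrite -[LHS](vsubK P) -[RHS](vsubK P) !acomb_vsub //.
  by rewrite addrC.
by rewrite addrC.
Qed.

Definition affine (f : A -> R) := forall P Q a b, a + b = 1 ->
  f (acomb a P b Q) = a * f P + b * f Q.

Definition midpoint P Q : A := acomb (2^-1) P (2^-1) Q.

Definition quadratic (d : A -> R) := forall P Q a b, a + b = 1 ->
  d (acomb a P b Q) =
    a * (a - b) * d P + b * (b - a) * d Q + 4 * a * b * d (midpoint P Q).

Lemma affine_quadratic f : affine f -> quadratic f.
Proof.
move=> hf P Q a b ab1; rewrite hf // /midpoint hf; last by field.
have -> : a = 1 - b by rewrite -ab1 addrK.
by field.
Qed.

Definition affine_pred : {pred A -> R^o} := fun f => `[< affine f >].
Definition quadratic_pred : {pred A -> R^o} := fun d => `[< quadratic d >].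

Lemma affine_submod_closed : subsemimod_closed affine_pred.
Proof.
split; first split.
- by apply/asboolP => P Q a b _; rewrite /= !mulr0 addr0.
- move=> f g /asboolP hf /asboolP hg; apply/asboolP => P Q a b ab1.
  by rewrite !fctE hf // hg //; ring.
- move=> c f /asboolP hf; apply/asboolP => P Q a b ab1.
  by rewrite !scalrfctE hf // /GRing.scale /=; ring.
Qed.

HB.instance Definition _ :=
  GRing.isSubmodClosed.Build R (A -> R^o) affine_pred affine_submod_closed.

Lemma quadratic_submod_closed : subsemimod_closed quadratic_pred.
Proof.
split; first split.
- by apply/asboolP => P Q a b _; rewrite /= !mulr0 !addr0.
- move=> f g /asboolP hf /asboolP hg; apply/asboolP => P Q a b ab1.
  by rewrite !fctE hf // hg //; ring.
- move=> c f /asboolP hf; apply/asboolP => P Q a b ab1.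
  by rewrite !scalrfctE hf // /GRing.scale /=; ring.
Qed.

HB.instance Definition _ :=
  GRing.isSubmodClosed.Build R (A -> R^o) quadratic_pred quadratic_submod_closed.

Record Aff := MkAff { aff_fun :> A -> R^o; _ : aff_fun \in affine_pred }.

HB.instance Definition _ := [isSub for aff_fun].
HB.instance Definition _ := [Choice of Aff by <:].
HB.instance Definition _ := [SubChoice_isSubLmodule of Aff by <:].

Record Quad := MkQuad { quad_fun :> A -> R^o; _ : quad_fun \in quadratic_pred }.

HB.instance Definition _ := [isSub for quad_fun].
HB.instance Definition _ := [Choice of Quad by <:].
HB.instance Definition _ := [SubChoice_isSubLmodule of Quad by <:].

Lemma affP (f : Aff) : affine f. Proof. by case: f => f /= /asboolP. Qed.
Lemma quadP (d : Quad) : quadratic d. Proof. by case: d => f /= /asboolP. Qed.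

Definition aff_of f (hf : affine f) : Aff := MkAff (asboolT hf).

Lemma aff_ext (f g : Aff) : f =1 g -> f = g.
Proof. by move=> fg; apply: val_inj; apply: funext. Qed.
Lemma quad_ext (f g : Quad) : f =1 g -> f = g.
Proof. by move=> fg; apply: val_inj; apply: funext. Qed.

Lemma addAffE (f g : Aff) P : (f + g) P = f P + g P. Proof. by []. Qed.
Lemma scaleAffE c (f : Aff) P : (c *: f) P = c * f P. Proof. by []. Qed.
Lemma addQuadE (f g : Quad) P : (f + g) P = f P + g P. Proof. by []. Qed.
Lemma oppQuadE (f : Quad) P : (- f) P = - f P. Proof. by []. Qed.
Lemma scaleQuadE c (f : Quad) P : (c *: f) P = c * f P. Proof. by []. Qed.

Definition aff_lin (f : Aff) P (v : V) : R^o := f (P +@ v) - f P.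

Lemma aff_lin_linear f P : linear (aff_lin f P).
Proof.
have hZ a v : aff_lin f P (a *: v) = a * aff_lin f P v.
  have -> : aff_lin f P (a *: v) = f (acomb (1 - a) P a (P +@ v)) - f P.
    by rewrite /acomb vaddK.
  by rewrite (affP f) ?subrK // /aff_lin; ring.
have hD u v : aff_lin f P (u + v) = aff_lin f P u + aff_lin f P v.
  have -> : aff_lin f P (u + v) =
      f (acomb (2^-1) (P +@ (2 *: u)) (2^-1) (P +@ (2 *: v))) - f P.
    congr (f _ - _); rewrite -[RHS](vsubK P) acomb_vsub; last by field.
    by rewrite !vaddK !scalerA !mulVf ?scale1r ?pnatr_eq0.
  have h w : f (P +@ (2 *: w)) = 2 * aff_lin f P w + f P by rewrite -hZ subrK.
  by rewrite (affP f) ?h; field.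
by move=> a u v; rewrite hD hZ.
Qed.

HB.instance Definition _ (f : Aff) P :=
  GRing.isLinear.Build R V R^o _ (aff_lin f P) (aff_lin_linear f P).

Lemma affE (f : Aff) P Q : f Q = f P + aff_lin f P (Q -@ P).
Proof. by rewrite /aff_lin vsubK addrC subrK. Qed.

Lemma affine_of_linear P (c : R) (l : {linear V -> R^o}) :
  affine (fun Q => c + l (Q -@ P)).
Proof.
move=> Q1 Q2 a b ab1; rewrite acomb_vsub // linearP linearZ /=.
have -> : a = 1 - b by rewrite -ab1 addrK.
by rewrite /GRing.scale /=; ring.
Qed.

(* Aff(A) is linearly isomorphic to R x V^*, through the value at the origin
   and the linear part. *)
Let W : vectType R := (R^o * 'Hom(V, R^o))%type.

Definition aff_split (f : Aff) : W :=
  (f origin, linfun (aff_lin f origin)).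

Definition aff_join (x : W) : Aff :=
  aff_of (affine_of_linear origin x.1 x.2).

Lemma aff_splitK : cancel aff_split aff_join.
Proof. by move=> f; apply: aff_ext => P /=; rewrite lfunE -affE. Qed.

Lemma aff_joinK : cancel aff_join aff_split.
Proof.
move=> [c l]; congr pair => /=.
  by rewrite vsubxx linear0 addr0.
apply/lfunP => v; rewrite lfunE /= /aff_lin /= vaddK.
by rewrite vsubxx linear0 addr0 addrC addKr.
Qed.

Lemma aff_split_linear : linear aff_split.
Proof.
move=> a f g; congr pair; apply/lfunP => v.
rewrite lfunE add_lfunE scale_lfunE !lfunE /=.
by rewrite /aff_lin !addAffE !scaleAffE /GRing.scale /=; ring.
Qed.

Lemma aff_vector_axiom : Vector.axiom (dim W) Aff.
Proof.
exists (fun f => v2r (aff_split f)).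
  by move=> a f g; rewrite aff_split_linear linearP.
exists (fun r => aff_join (r2v r)).
  by move=> f; rewrite v2rK aff_splitK.
by move=> r; rewrite aff_joinK r2vK.
Qed.

HB.instance Definition _ := Lmodule_hasFinDim.Build R Aff aff_vector_axiom.

Definition Aff_in_Quad : {pred Quad} := fun d => affine_pred d.

Lemma Aff_in_Quad_submod_closed : subsemimod_closed Aff_in_Quad.
Proof.
have [[h0 hD] hZ] := affine_submod_closed.
by split; [split=> // f g; apply: hD | move=> a f; apply: hZ].
Qed.

HB.instance Definition _ :=
  GRing.isSubmodClosed.Build R Quad Aff_in_Quad Aff_in_Quad_submod_closed.

Definition quad_of_aff (s : Aff) : Quad :=
  MkQuad (asboolT (affine_quadratic (@affP s))).

Lemma quad_of_affE (s : Aff) P : quad_of_aff s P = s P. Proof. by []. Qed.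

Lemma quad_of_aff_in s : quad_of_aff s \in Aff_in_Quad.
Proof. by apply/asboolP; exact: affP. Qed.

Definition Met : Type := Quotient.quot Aff_in_Quad.

HB.instance Definition _ := GRing.Zmodule.on Met.
HB.instance Definition _ := Quotient.on Met.

Lemma metP (d d' : Quad) :
  reflect (exists s : Aff, d = d' + quad_of_aff s)
          (\pi_Met d == \pi_Met d').
Proof.
apply: (iffP idP) => [|[s ->]].
  rewrite -Quotient.idealrBE => /asboolP h; exists (aff_of h).
  by apply: quad_ext => P; rewrite addQuadE quad_of_affE /= addrC subrK.
by rewrite -Quotient.idealrBE [X in X - _]addrC addrK quad_of_aff_in.
Qed.

Definition met_scale (a : R) (m : Met) : Met := \pi_Met (a *: repr m).

Lemma pi_met_scale a (d : Quad) : met_scale a (\pi_Met d) = \pi_Met (a *: d).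
Proof.
apply/eqP; rewrite -Quotient.idealrBE -scalerBr rpredZ //.
by rewrite Quotient.idealrBE reprK.
Qed.

Lemma pi_metD (d d' : Quad) : \pi_Met (d + d') = \pi_Met d + \pi_Met d'.
Proof. exact: Quotient.pi_add. Qed.

Lemma met_surj (m : Met) : exists d, m = \pi_Met d.
Proof. by exists (repr m); rewrite reprK. Qed.

Fact met_scaleA a b m : met_scale a (met_scale b m) = met_scale (a * b) m.
Proof.
have [d ->] := met_surj m.
by rewrite (pi_met_scale b d) (pi_met_scale a (b *: d)) pi_met_scale scalerA.
Qed.
Fact met_scale1 : left_id 1 met_scale.
Proof.
by move=> m; have [d ->] := met_surj m; rewrite pi_met_scale scale1r.
Qed.
Fact met_scaleDr : right_distributive met_scale +%R.
Proof.
move=> a m m'; have [d ->] := met_surj m; have [d' ->] := met_surj m'.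
rewrite -pi_metD (pi_met_scale a (d + d')) scalerDr pi_metD.
by rewrite (pi_met_scale a d) (pi_met_scale a d').
Qed.
Fact met_scaleDl m : {morph met_scale^~ m : a b / a + b}.
Proof.
move=> a b; have [d ->] := met_surj m.
rewrite (pi_met_scale (a + b) d) scalerDl pi_metD.
by rewrite (pi_met_scale a d) (pi_met_scale b d).
Qed.

HB.instance Definition _ := GRing.Zmodule_isLmodule.Build R Met
  met_scaleA met_scale1 met_scaleDr met_scaleDl.

Section QuadM.
Variable m : Met.

Record quadM := MkQuadM { quadM_val :> Quad; quadMP : \pi_Met quadM_val = m }.

Lemma quadM_ext (d d' : quadM) : (d : Quad) =1 (d' : Quad) -> d = d'.
Proof.
case: d d' => [d dP] [d' d'P] /= /quad_ext dd'.
by case: _ / dd' in d'P *; congr MkQuadM; apply: Prop_irrelevance.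
Qed.

Fact quadM_add_subproof (d : quadM) (s : Aff) :
  \pi_Met (quadM_val d + quad_of_aff s) = m.
Proof. by rewrite -(quadMP d); apply/eqP/metP; exists s. Qed.
Definition quadM_add d s : quadM := MkQuadM (quadM_add_subproof d s).

Fact quadM_sub_subproof (d d' : quadM) :
  affine (fun P => quadM_val d P - quadM_val d' P).
Proof.
have /eqP/metP[s ->] : \pi_Met (quadM_val d) = \pi_Met (quadM_val d').
  by rewrite !quadMP.
move=> P Q a b ab1; rewrite !addQuadE !quad_of_affE (affP s) //; ring.
Qed.
Definition quadM_sub d d' : Aff := aff_of (quadM_sub_subproof d d').

Fact quadM_add0 d : quadM_add d 0 = d.
Proof. by apply: quadM_ext => P; exact: addr0. Qed.
Fact quadM_addA d s t : quadM_add (quadM_add d s) t = quadM_add d (s + t).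
Proof. by apply: quadM_ext => P; symmetry; exact: addrA. Qed.
Fact quadM_subK d d' : quadM_add d (quadM_sub d' d) = d'.
Proof. by apply: quadM_ext => P; exact: subrKC. Qed.
Fact quadM_addK d s : quadM_sub (quadM_add d s) d = s.
Proof. by apply: aff_ext => P; change (quadM_val d P + s P - quadM_val d P = s P); rewrite addrC addKr. Qed.
Fact quadM_inhabited : inhabited quadM.
Proof. by constructor; exists (repr m); rewrite reprK. Qed.

Definition QuadM : affineSpace Aff :=
  AffineSpace quadM_add0 quadM_addA quadM_subK quadM_addK quadM_inhabited.

End QuadM.

Definition affinely_independent k (r : 'I_k.+1 -> A) :=
  free [tuple r (lift ord0 i) -@ r ord0 | i < k].

Record referential := Referential {
  ref_pt :> 'I_(adim A).+1 -> A;
  referentialP : affinely_independent ref_pt }.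

Section Referential.
Variable r : referential.

Let X : (adim A).-tuple V := [tuple r (lift ord0 i) -@ r ord0 | i < adim A].

Lemma ref_basis : basis_of fullv X.
Proof. rewrite basisEfree subvf size_tuple leqnn !andbT; exact: referentialP. Qed.

Lemma aff_ref_inj (f g : Aff) : (forall j, f (r j) = g (r j)) -> f = g.
Proof.
move=> fg; apply: aff_ext => P; rewrite (affE f (r ord0)) (affE g (r ord0)) fg.
congr (_ + _); rewrite (coord_basis ref_basis (memvf (P -@ r ord0))) !linear_sum.
apply: eq_bigr => i _; rewrite !linearZ -!tnth_nth tnth_mktuple.
by rewrite /= /aff_lin !vsubK !fg.
Qed.

Lemma bary_exists :
  exists w : 'I_(adim A).+1 -> Aff, forall i j, w i (r j) = (i == j)%:R.
Proof.
pose c i : Aff := aff_of (affine_of_linear (r ord0) 0 (coord X i)).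
have cE i j : c i (r (lift ord0 j)) = (i == j)%:R.
  rewrite /= add0r.
  have -> : r (lift ord0 j) -@ r ord0 = X`_j by rewrite -tnth_nth tnth_mktuple.
  by rewrite coord_free 1?eq_sym; last exact: referentialP.
have c0 i : c i (r ord0) = 0 by rewrite /= add0r vsubxx linear0.
have h1 : affine (fun=> 1) by move=> P Q a b ab1; rewrite !mulr1 ab1.
have sumE P : (\sum_i c i) P = \sum_i c i P.
  by elim/big_rec2: _ => [//|i x y _ <-]; rewrite addAffE.
exists (fun i => if unlift ord0 i is Some k then c k
                 else aff_of h1 - \sum_i c i) => i j.
have E P : (aff_of h1 - \sum_i c i) P = 1 - \sum_i c i P by rewrite -sumE.
clearbody c.
case: (unliftP ord0 i) => [i' ->|->]; case: (unliftP ord0 j) => [j' ->|->].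
- by rewrite cE (inj_eq lift_inj).
- by rewrite c0 eq_sym (negPf (neq_lift _ _)).
- rewrite E (bigD1 j') //= cE eqxx big1 ?addr0 ?subrr ?(negPf (neq_lift _ _)) //.
  by move=> k /negPf kj; rewrite cE kj.
- by rewrite E big1 ?subr0 ?eqxx.
Qed.

Definition bary : 'I_(adim A).+1 -> Aff := sval (cid bary_exists).

Lemma baryE i j : bary i (r j) = (i == j)%:R.
Proof. exact: (svalP (cid bary_exists)). Qed.

Lemma bary_unique (w : 'I_(adim A).+1 -> Aff) :
  (forall i j, w i (r j) = (i == j)%:R) -> w = bary.
Proof.
by move=> wE; apply: funext => i; apply: aff_ref_inj => j; rewrite wE baryE.
Qed.

Lemma reduced_exists (m : Met) :
  exists! d : quadM m, forall i, d (r i) = 0.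
Proof.
have [d0] := quadM_inhabited m.
pose s : Aff := - \sum_i d0 (r i) *: bary i.
have sE j : s (r j) = - d0 (r j).
  have sumE P : (\sum_i d0 (r i) *: bary i) P = \sum_i d0 (r i) * bary i P.
    by elim/big_rec2: _ => [//|i x y _ <-]; rewrite addAffE.
  rewrite -[LHS]/(- (\sum_i d0 (r i) *: bary i) (r j)) sumE (bigD1 j) //=.
  rewrite baryE eqxx mulr1 big1 ?addr0 // => k /negPf kj.
  by rewrite baryE kj mulr0.
exists (quadM_add d0 s); split=> [j|d dE].
  by rewrite -[LHS]/(d0 (r j) + s (r j)) sE subrr.
rewrite -[d](quadM_subK d0); congr quadM_add; apply: aff_ref_inj => j.
by rewrite sE -[RHS]/(d (r j) - d0 (r j)) dE sub0r.
Qed.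

Definition reduced (m : Met) : quadM m := sval (cid (reduced_exists m)).

Lemma reducedE m i : reduced m (r i) = 0.
Proof. exact: (svalP (cid (reduced_exists m))).1. Qed.

Lemma reduced_unique m (d : quadM m) :
  (forall i, d (r i) = 0) -> d = reduced m.
Proof. by move=> dE; rewrite -((svalP (cid (reduced_exists m))).2 d dE). Qed.

End Referential.

End AffineSpaceTheory.

Section LinearHull.
Variables (R : realType) (W : vectType R) (B : affineSpace W).

Definition linear_hull : vectType R := 'Hom(Aff B, R^o).

Definition pairing_pt (d : B) (v : Aff B) : R^o := v d.

Lemma pairing_pt_linear d : linear (pairing_pt d).
Proof. by []. Qed.

HB.instance Definition _ d :=
  GRing.isLinear.Build R (Aff B) R^o _ (pairing_pt d) (pairing_pt_linear d).

Definition hull_pt (d : B) : linear_hull := linfun (pairing_pt d).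

Lemma hull_ptE d v : hull_pt d v = v d.
Proof. by rewrite lfunE. Qed.

Lemma hull_pt_inj : injective hull_pt.
Proof.
move=> d d' dd'; have Xb := vbasisP (@fullv R W).
rewrite -[d](vsubK d'); suff -> : d -@ d' = 0 by rewrite vadd0.
rewrite (coord_basis Xb (memvf (d -@ d'))) big1 // => i _.
have := congr1 (fun h : linear_hull =>
  h (aff_of (affine_of_linear d' 0 (coord (vbasis fullv) i)))) dd'.
by rewrite !hull_ptE /= !add0r vsubxx linear0 => ->; rewrite scale0r.
Qed.

Definition pairing_vec (s : W) (v : Aff B) : R^o :=
  v (origin B +@ s) - v (origin B).

Lemma pairing_vec_linear s : linear (pairing_vec s).
Proof.
move=> a u v; rewrite /pairing_vec !addAffE !scaleAffE /GRing.scale /=; ring.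
Qed.

HB.instance Definition _ s :=
  GRing.isLinear.Build R (Aff B) R^o _ (pairing_vec s) (pairing_vec_linear s).

(* The embedding of the director space into the linear hull, as the dual of
   the map sending an affine functional to its linear part. *)
Definition hull_vec (s : W) : linear_hull := linfun (pairing_vec s).

Lemma hull_vecE s (d : B) v : hull_vec s v = v (d +@ s) - v d.
Proof.
rewrite lfunE /= /pairing_vec.
rewrite (affE v (origin B) (d +@ s)) (affE v (origin B) d) vsubC linearD.
have E (x y z : R) : z = x + (y + z) - (x + y) by ring.
exact: E.
Qed.

Lemma hull_vec_inj : injective hull_vec.
Proof.
move=> s t st; have O := origin B.
suff /hull_pt_inj E : hull_pt (O +@ s) = hull_pt (O +@ t).
  by rewrite -(vaddK O s) E vaddK.
apply/lfunP => v; rewrite !hull_ptE.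
apply: (addIr (- v O)); rewrite -!hull_vecE st //.
Qed.

End LinearHull.

Section QuadMFunctionals.
Variables (R : realType) (V : vectType R) (A : affineSpace V) (m : Met A).

Lemma quad_eval_affine (P : A) : affine (fun d : QuadM m => (d : quadM m) P).
Proof.
move=> d d' a b ab1.
rewrite -[LHS]/((d : quadM m) P + b * ((d' : quadM m) P - (d : quadM m) P)).
have -> : a = 1 - b by rewrite -ab1 addrK.
by ring.
Qed.

Definition quad_eval (P : A) : Aff (QuadM m) := aff_of (quad_eval_affine P).

Lemma quad_one_affine : affine (fun _ : QuadM m => 1).
Proof. by move=> d d' a b ab1; rewrite !mulr1. Qed.

Definition quad_one : Aff (QuadM m) := aff_of quad_one_affine.

End QuadMFunctionals.

Definition is_dual_basis (R : realType) (W : vectType R) (k : nat)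
    (X : k.-tuple W) (Y : k.-tuple 'Hom(W, R^o)) :=
  basis_of fullv Y /\ forall i j, tnth Y i (tnth X j) = (i == j)%:R.

(* Main.v *)
Require Import Defs.
From HB Require Import structures.
From mathcomp Require Import all_boot all_order all_algebra.
From mathcomp Require Import all_classical all_reals.

Set Implicit Arguments.
Unset Strict Implicit.
Unset Printing Implicit Defensive.

Import GRing.Theory Num.Theory.
Local Open Scope ring_scope.

(** The whole statement is an expansion formula.  Subtracting from a quadratic
    function [d] of the class [m] the affine function that interpolates it at
    the referential leaves the reduced function [d0], so that
    [d = d0 + \sum_i d (r i) *: bary r i].  Applying an affine functional [v]
    splits it into its value at [d0] and its linear part:
    [v d = v d0 * 1 + \sum_i <bary r i, v> * d (r i)].
    Read as an identity in [v], this says that the evaluations at the [r i]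
    and the constant functional span, with coefficients the pairings of [v]
    with the proposed dual basis ([aff_QuadM_expansion]).  The two families are
    biorthogonal because [bary r i] is 1 at [r i] and 0 at the other points,
    where [d0] vanishes too, and because a constant has no linear part.
    Spanning and biorthogonality together give two bases dual to each other
    ([biorthogonal_dual_basis]), so no dimension has to be computed. *)

Lemma tnth_rcons_lift T n (t : n.-tuple T) x i :
  tnth (rcons_tuple t x) (lift ord_max i) = tnth t i.
Proof. by rewrite !(tnth_nth x) nth_rcons lift_max size_tuple ltn_ord. Qed.

Lemma tnth_rcons_max T n (t : n.-tuple T) x :
  tnth (rcons_tuple t x) ord_max = x.
Proof. by rewrite (tnth_nth x) nth_rcons size_tuple ltnn eqxx. Qed.

Lemma lincomb_aff_funE (R : realType) (V : vectType R) (A : affineSpace V)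
    (I : Type) (s : seq I) (c : I -> R) (f : I -> Aff A) P :
  (\sum_(i <- s) c i *: f i) P = \sum_(i <- s) c i * f i P.
Proof. by elim/big_rec2: _ => [//|i x y _ <-]; rewrite addAffE. Qed.

(** Biorthogonality makes both families free: pairing a relation with the
    other family isolates each coefficient.  Conversely, evaluating a linear
    form [h] on the expansion of [v] gives [h = \sum_i h (X_i) *: Y_i], so that
    the single expansion hypothesis makes both families span. *)
Lemma biorthogonal_dual_basis (R : realType) (W : vectType R) k
    (X : k.-tuple W) (Y : k.-tuple 'Hom(W, R^o)) :
  (forall i j, tnth Y i (tnth X j) = (i == j)%:R) ->
  (forall v, v = \sum_i (tnth Y i v : R) *: tnth X i) ->
  basis_of fullv X /\ is_dual_basis X Y.
Proof.
move=> XY expX.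
have sumX (a : 'I_k -> R) j : tnth Y j (\sum_i a i *: tnth X i) = a j.
  rewrite linear_sum (bigD1 j) //= linearZ /= XY eqxx.
  rewrite big1 => [|i /negPf ij]; first by rewrite addr0; exact: mulr1.
  by rewrite linearZ /= XY eq_sym ij; exact: mulr0.
have sumY (a : 'I_k -> R) j : (\sum_i a i *: tnth Y i) (tnth X j) = a j.
  rewrite sum_lfunE (bigD1 j) //= scale_lfunE XY eqxx.
  rewrite big1 => [|i /negPf ij]; first by rewrite addr0; exact: mulr1.
  by rewrite scale_lfunE XY ij; exact: mulr0.
split; [|split=> //]; rewrite basisEdim; apply/andP; split.
- apply/subvP => v _; rewrite (expX v) memv_suml // => i _.
  by rewrite memvZ // memv_span // mem_tnth.
- have /eqP <- : free X.
    apply/freeP => a; under eq_bigr do rewrite -tnth_nth.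
    by move=> a0 j; rewrite -(sumX a) a0 linear0.
  exact: dimvS (subvf _).
- apply/subvP => h _.
  have -> : h = \sum_i (h (tnth X i) : R) *: tnth Y i.
    apply/lfunP => v; rewrite {1}(expX v) linear_sum sum_lfunE.
    apply: eq_bigr => i _; rewrite linearZ scale_lfunE; exact: mulrC.
  by rewrite memv_suml // => i _; rewrite memvZ // memv_span // mem_tnth.
- have /eqP <- : free Y.
    apply/freeP => a; under eq_bigr do rewrite -tnth_nth.
    by move=> a0 j; rewrite -(sumY a) a0 zero_lfunE.
  exact: dimvS (subvf _).
Qed.

Lemma hull_vec_quad_eval (R : realType) (V : vectType R) (A : affineSpace V)
    (m : Met A) (s : Aff A) P :
  hull_vec (QuadM m) s (quad_eval m P) = s P.
Proof.
pose d := origin (QuadM m); rewrite (hull_vecE _ d).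
rewrite -[LHS]/((d : quadM m) P + s P - (d : quadM m) P).
by rewrite addrC addKr.
Qed.

Lemma hull_vec_quad_one (R : realType) (V : vectType R) (A : affineSpace V)
    (m : Met A) (s : Aff A) : hull_vec (QuadM m) s (quad_one m) = 0.
Proof. by rewrite (hull_vecE _ (origin (QuadM m))); exact: subrr. Qed.

Section ReducedExpansion.
Variables (R : realType) (V : vectType R) (A : affineSpace V).
Variables (r : referential A) (m : Met A).

Let d0 : QuadM m := reduced r m.

Lemma bary_interpolation (s : Aff A) : s = \sum_i (s (r i) : R) *: bary r i.
Proof.
apply: (aff_ref_inj (r := r)) => j; rewrite lincomb_aff_funE.
rewrite (bigD1 j) //= baryE eqxx mulr1 big1 ?addr0 // => i /negPf ij.
by rewrite baryE ij mulr0.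
Qed.

Lemma vsub_reducedE (d : QuadM m) :
  d -@ d0 = \sum_i ((d : quadM m) (r i) : R) *: bary r i.
Proof.
rewrite [LHS]bary_interpolation; apply: eq_bigr => i _; congr (_ *: _).
rewrite -[LHS]/((d : quadM m) (r i) - (d0 : quadM m) (r i)).
by rewrite reducedE subr0.
Qed.

(** At a point [d], an affine functional differs from its value at [d0] by its
    linear part applied to [d -@ d0], whose barycentric coefficients are the
    values [d (r i)]: these are the evaluation functionals taken at [d]. *)
Lemma aff_QuadM_expansion (v : Aff (QuadM m)) :
  v = \sum_i (hull_vec (QuadM m) (bary r i) v : R) *: quad_eval m (r i)
      + (hull_pt d0 v : R) *: quad_one m.
Proof.
apply: aff_ext => d.
rewrite addAffE lincomb_aff_funE scaleAffE hull_ptE mulr1 (affE v d0 d) addrC.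
congr (_ + _); rewrite vsub_reducedE linear_sum; apply: eq_bigr => i _.
by rewrite linearZ (hull_vecE _ d0); exact: mulrC.
Qed.

End ReducedExpansion.

Theorem proposition5p7 (R : realType) (V : vectType R) (A : affineSpace V)
    (m : Met A) (r : referential A) :
  let v : (adim A).+2.-tuple (Aff (QuadM m)) :=
    rcons_tuple [tuple quad_eval m (r i) | i < (adim A).+1] (quad_one m) in
  let w : (adim A).+2.-tuple (linear_hull (QuadM m)) :=
    rcons_tuple [tuple hull_vec (QuadM m) (bary r i) | i < (adim A).+1]
                (hull_pt (reduced r m : QuadM m)) in
  basis_of fullv v /\ is_dual_basis v w.
Proof.
apply: biorthogonal_dual_basis => [i j|u].
- case: (unliftP ord_max i) => [i' ->|->]; case: (unliftP ord_max j) => [j' ->|->];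
    rewrite ?tnth_rcons_lift ?tnth_rcons_max ?tnth_mktuple.
  + rewrite (inj_eq lift_inj).
    by apply: etrans (hull_vec_quad_eval _ _ _) _; exact: baryE.
  + rewrite eq_sym (negPf (neq_lift _ _)); exact: hull_vec_quad_one.
  + rewrite (negPf (neq_lift _ _)).
    by apply: etrans (hull_ptE _ _) _; exact: reducedE.
  + by rewrite eqxx; exact: hull_ptE.
- rewrite [LHS](aff_QuadM_expansion r u) [RHS]big_ord_recr /= !tnth_rcons_max.
  congr (_ + _); apply: eq_bigr => i _.
  have -> : widen_ord (leqnSn _) i = lift ord_max i.
    by apply: ord_inj; rewrite lift_max.
  by rewrite !tnth_rcons_lift !tnth_mktuple.
Qed.
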